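(* Let $q$ be a prime power. Assume that $n$ is odd and $(n-1)\mid(q^2-1)$. Put $k=\lfloor\frac{n+q-1}{q+1}\rfloor$ and $i_{\min}=\min\left(\lfloor\frac{n-q}{2}\rfloor-k,\;q-1\right)$. Assume further that $(n-1)\mid k(q+1)$. Then, for any $1\le k'\le k+i_{\min}+1$ and each integer $j$ with $0\le j\le k'-\sharp\Delta_{k'}$, there exists an MDS linear code $C$ with parameters $[n,k',n-k'+1]_{q^2}$ such that $\dim(\mathrm{Hull}_H(C))=j$.
   Context: An $[n,k,d]_{q^2}$ code is a linear code over $\mathbb{F}_{q^2}$ of length $n$, dimension $k$ and minimum Hamming distance $d$; it is MDS if $d=n-k+1$. The Hermitian inner product on $\mathbb{F}_{q^2}^n$ is $\langle x,y\rangle_H=\sum_i x_iy_i^q$, $C^{\perp_H}$ is the dual of $C$ with respect to it, and $\mathrm{Hull}_H(C)=C\cap C^{\perp_H}$. Definition of $\Delta_m$: let $\alpha_1,\dots,\alpha_{n-1}$ be the $n-1$ distinct elements of $\mathbb{F}_{q^2}$ with $\alpha_i^{n-1}=1$, let $\alpha_n=0$, put $u_i=\prod_{j\ne i}(\alpha_i-\alpha_j)^{-1}$ for $1\le i\le n$ (these lie in $\mathbb{F}_q^*$), and choose $v_i\in\mathbb{F}_{q^2}^*$ with $v_i^{q+1}=u_i$. For $j\ge0$ put $\delta_j=\sum_{l=1}^n v_l^{q+1}\alpha_l^{j(q+1)}$ (with $0^0=1$). For $m\ge1$, $\Delta_m=\{j:0\le j\le m-1,\ \delta_j\ne0\}$,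 and $\sharp\Delta_m$ is its cardinality. *)

(* Defs.v *)
From HB Require Import structures.
From mathcomp Require Import all_boot all_order all_algebra.

Set Implicit Arguments.
Unset Strict Implicit.
Unset Printing Implicit Defensive.

Import Order.TTheory GRing.Theory Num.Theory.
Local Open Scope ring_scope.

Definition prime_power (q : nat) : Prop :=
  exists p e : nat, [/\ prime p, (0 < e)%N & q = (p ^ e)%N].

Section Codes.

Variables (F : finFieldType) (n : nat).
Implicit Types (x y : 'rV[F]_n) (C : {vspace 'rV[F]_n}).

Definition hamming_dist x y : nat := #|[set i | x 0 i != y 0 i]|.

Definition min_distance C (d : nat) : Prop :=
  (exists x y, [/\ x \in C, y \in C, x != y & hamming_dist x y = d]) /\
  (forall x y, x \in C -> y \in C -> x != y -> (d <= hamming_dist x y)%N).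

Definition code_params C (k d : nat) : Prop := \dim C = k /\ min_distance C d.

Definition MDS C : Prop := min_distance C (n - \dim C + 1).

(* herm q y x is <x, y>_H: the argument in which it is linear comes last, so
   that herm q y can be made a linear function. *)
Definition herm (q : nat) y x : F^o := \sum_i x 0 i * y 0 i ^+ q.

Lemma herm_linear q y : linear (herm q y).
Proof.
move=> a x z; rewrite /herm scaler_sumr -big_split /=.
by apply: eq_bigr => i _; rewrite !mxE mulrDl -mulrA.
Qed.

HB.instance Definition _ q y :=
  GRing.isLinear.Build F 'rV[F]_n F^o _ (herm q y) (herm_linear q y).

Definition herm_dual (q : nat) C : {vspace 'rV[F]_n} :=
  (\bigcap_(y : 'rV[F]_n | y \in C) lker (linfun (herm q y)))%VS.

Lemma herm_dualP q C x :
  reflect (forall y, y \in C -> herm q y x = 0) (x \in herm_dual q C).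
Proof.
rewrite memvE; apply: (iffP subv_bigcapP) => [h y yC | h y yC].
  by have := h y yC; rewrite -memvE memv_ker lfunE /= => /eqP.
by rewrite -memvE memv_ker lfunE /= h.
Qed.

Definition herm_hull (q : nat) C : {vspace 'rV[F]_n} :=
  (C :&: herm_dual q C)%VS.

End Codes.

Section Delta.

Variables (F : finFieldType) (q n : nat) (alpha v : 'I_n -> F).

(* The indices 1, ..., n are shifted to 0, ..., n-1, so that alpha_n is the
   value of alpha at the last element of 'I_n. *)
Definition evaluation_points : Prop :=
  [/\ injective alpha,
      forall i : 'I_n, (i < n.-1)%N -> alpha i ^+ n.-1 = 1
    & forall i : 'I_n, i = n.-1 :> nat -> alpha i = 0].

Definition u_coef (i : 'I_n) : F :=
  \prod_(j < n | j != i) (alpha i - alpha j)^-1.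

Definition column_multipliers : Prop :=
  forall i : 'I_n, v i != 0 /\ v i ^+ q.+1 = u_coef i.

Definition delta (j : nat) : F :=
  \sum_(l < n) v l ^+ q.+1 * alpha l ^+ (j * q.+1).

Definition Delta (m : nat) : {set 'I_m} := [set j : 'I_m | delta j != 0].

End Delta.

Definition kdim (n q : nat) : nat := (n + q - 1) %/ (q + 1).

(* Over int: n - q, hence i_min, may be negative. *)
Definition i_min (n q : nat) : int :=
  Num.min (((n%:Z - q%:Z) %/ 2)%Z - (kdim n q)%:Z) (q%:Z - 1).

(* Main.v *)
(* C is the generalized Reed-Solomon code spanned by e_a = (v_l alpha_l^a)_l,
   a < k'. Since <e_b, e_a>_H = sum_l u_l alpha_l^(b + q a), which vanishes unless
   n - 1 divides b + q a, and the hypotheses on k' leave only a = b, the e_a are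
   pairwise orthogonal. Those with delta_a = 0 thus lie in the hull, which has
   dimension at least k' - #Delta_k'. Any smaller dimension is reached by scaling
   coordinates, which preserves the weights: one suitable scaling lowers the
   dimension of the hull by exactly one. *)
Require Import Defs.
From mathcomp Require Import all_boot all_order all_algebra all_solvable all_field.
From mathcomp Require Import zify.

Set Implicit Arguments.
Unset Strict Implicit.
Unset Printing Implicit Defensive.

Import Order.TTheory GRing.Theory Num.Theory.
Local Open Scope ring_scope.

(** * The [q]-power map and elements of norm other than 1 *)

(** [q] is a power of the characteristic, so raising to the [q] is an iterate of Frobenius. *)
Lemma expr_sum_card_sqr (F : finFieldType) (q : nat) (I : Type) (r : seq I)
    (f : I -> F) :
  prime_power q -> #|F| = (q ^ 2)%N ->
  (\sum_(i <- r) f i) ^+ q = \sum_(i <- r) f i ^+ q.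
Proof.
move=> [p [e [p_pr e_gt0 ->]]]; rewrite -expnM => cardF.
have pcharF := card_finPcharP cardF p_pr.
apply: (big_morph (fun x => x ^+ _)) => [x y|]; last first.
  by rewrite expr0n expn_eq0 -leqn0 leqNgt prime_gt0.
apply: exprDn_pchar; rewrite pnatX (eq_pnat _ (pcharf_eq pcharF)).
by rewrite pnat_id.
Qed.

(** Since [x^(q^2) = x] in [F], the form is conjugate-symmetric; this moves a vector between the
    linear and the conjugated argument. *)
Lemma herm_conj (F : finFieldType) (q n : nat) (x y : 'rV[F]_n) :
  prime_power q -> #|F| = (q ^ 2)%N -> (herm q y x : F) ^+ q = herm q x y.
Proof.
move=> qP cardF; rewrite /herm expr_sum_card_sqr //; apply: eq_bigr => i _.
by rewrite exprMn -exprM mulnn -cardF expf_card mulrC.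
Qed.

(** Otherwise all [(q - 1)(q + 1)] nonzero elements would be roots of [X^(q+1) - 1], too many once
    [q > 2]. *)
Lemma exists_norm_neq1 (F : finFieldType) (q : nat) :
  (2 < q)%N -> #|F| = (q ^ 2)%N -> exists2 g : F, g != 0 & g ^+ q.+1 != 1.
Proof.
move=> q_gt2 cardF.
have [|/existsPn h] := boolP [exists g : F, (g != 0) && (g ^+ q.+1 != 1)].
  by case/existsP=> g /andP[]; exists g.
have: (size (enum [set g : F | g != 0%R]) <= q.+1)%N.
  apply: max_unity_roots; rewrite ?enum_uniq //.
  apply/allP=> g; rewrite mem_enum inE unity_rootE => gn0.
  by have := h g; rewrite gn0 negbK.
rewrite -cardE; have -> : [set g : F | g != 0] = [set~ 0].
  by apply/setP=> g; rewrite !inE.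
by rewrite cardsC1 cardF; nia.
Qed.

(** * Scaling coordinates and lowering the hull dimension *)

Definition scale (F : finFieldType) (n : nat) (d : 'rV[F]_n) :
  'End('rV[F]_n) := linfun (mulmxr (diag_mx d)).

Lemma scaleE (F : finFieldType) (n : nat) (d x : 'rV[F]_n) :
  scale d x = \row_i (x 0 i * d 0 i).
Proof. by rewrite lfunE /= mul_mx_diag; apply/rowP=> i; rewrite !mxE. Qed.

Lemma code_params_scale (F : finFieldType) (n : nat) (d : 'rV[F]_n)
    (C : {vspace 'rV[F]_n}) (k m : nat) :
  (forall i, d 0 i != 0) -> code_params C k m ->
  code_params (scale d @: C)%VS k m.
Proof.
move=> d0; set f := scale d.
have f_dist x y : hamming_dist (f x) (f y) = hamming_dist x y.
  rewrite /hamming_dist; congr #|pred_of_set _|; apply/setP=> i.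
  by rewrite !inE !scaleE !mxE (inj_eq (mulIf (d0 i))).
have f_inj : injective f.
  move=> x y /rowP fxy; apply/rowP=> i; have := fxy i.
  by rewrite !scaleE !mxE => /(mulIf (d0 i)).
move=> [dimC [[x [y [xC yC xy dxy]]] minC]]; split; last split.
- by rewrite limg_dim_eq // (eqP (introT lker0P f_inj)) capv0.
- exists (f x), (f y); split; rewrite ?memv_img ?f_dist ?inj_eq //.
- move=> _ _ /memv_imgP[x' x'C ->] /memv_imgP[y' y'C ->].
  by rewrite inj_eq // f_dist; apply: minC.
Qed.

(* If x lies in the hull of C and x_i != 0, multiplying coordinate i by g
   cuts the hull down to its hyperplane z_i = 0: testing z against x in the new
   form leaves only (g^(q+1) - 1) z_i x_i^q, as z is orthogonal to x in the old
   one. *)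
Lemma herm_hull_scale (F : finFieldType) (q n : nat) (C : {vspace 'rV[F]_n})
    (x : 'rV[F]_n) (i : 'I_n) (g : F) :
  prime_power q -> #|F| = (q ^ 2)%N ->
  x \in herm_hull q C -> x 0 i != 0 -> g ^+ q.+1 != 1 ->
  let d := \row_l (if l == i then g else 1) in
  forall z, (z \in herm_hull q (scale d @: C)%VS) =
            (z \in herm_hull q C) && (z 0 i == 0).
Proof.
move=> qP cardF; rewrite memv_cap => /andP[xC /herm_dualP xD] xi0 g1 d z.
set f := scale d.
have fE y : f y = y + ((g - 1) * y 0 i) *: delta_mx 0 i.
  apply/rowP=> l; rewrite scaleE !mxE eqxx /=.
  case: eqP => [->|_]; rewrite ?mulr1 ?mulr0 ?addr0 //.
  by rewrite mulrBl mul1r mulrC addrCA subrr addr0.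
have f_id (y : 'rV[F]_n) : y 0 i = 0 -> f y = y.
  by move=> y0; rewrite fE y0 mulr0 scale0r addr0.
have hermE (a b : 'rV[F]_n) : herm q (f b) (f a) =
    herm q b a + (g ^+ q.+1 - 1) * (a 0 i * b 0 i ^+ q).
  rewrite /herm (bigD1 i) //= [in RHS](bigD1 i) //=.
  rewrite !scaleE !mxE eqxx exprMn mulrBl mul1r.
  rewrite [RHS]addrC addrA subrK; congr (_ + _).
    by rewrite exprS mulrACA mulrC.
  by apply: eq_bigr => l li; rewrite !mxE (negPf li) !mulr1.
rewrite !memv_cap; apply/idP/idP.
- case/andP=> /memv_imgP[a aC ->] /herm_dualP aD.
  have a0 : a 0 i = 0.
    (* Test against [f x]: conjugating [herm q a x = 0] kills [herm q x a], so only the correction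
       term at [i] survives. *)
    have := aD _ (memv_img f xC); rewrite hermE -(herm_conj _ _ qP cardF) xD //.
    rewrite expr0n (gtn_eqF (_ : 0 < q)%N); last first.
      by case: qP => p [e [/prime_gt0 p0 _ ->]]; rewrite expn_gt0 p0.
    rewrite add0r => /eqP; rewrite !mulf_eq0 subr_eq0 (negPf g1) /=.
    by rewrite expf_eq0 (negPf xi0) andbF orbF => /eqP.
  rewrite f_id // a0 aC eqxx andbT /=; apply/herm_dualP=> b bC.
  have := aD _ (memv_img f bC).
  by rewrite hermE a0 mul0r mulr0 addr0.
- case/andP=> /andP[zC /herm_dualP zD] /eqP z0.
  rewrite -(f_id z) // memv_img //=; apply/herm_dualP=> _ /memv_imgP[b bC ->].
  by rewrite hermE z0 mul0r mulr0 addr0 zD.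
Qed.

(** Subtracting [(z_i / x_i) x] from [z] clears coordinate [i], so [U] is the direct sum of [V] and
    the line of [x]. *)
Lemma dim_coord_hyperplane (F : finFieldType) (n : nat) (U V : {vspace 'rV[F]_n})
    (x : 'rV[F]_n) (i : 'I_n) :
  x \in U -> x 0 i != 0 ->
  (forall z, (z \in V) = (z \in U) && (z 0 i == 0)) ->
  \dim U = (\dim V).+1.
Proof.
move=> xU xi0 VE.
have UE : (U = V + <[x]>)%VS.
  apply/vspaceP=> z; apply/idP/memv_addP => [zU|[a aV [_ /vlineP[c ->] ->]]].
    exists (z - (z 0 i / x 0 i) *: x); last first.
      by exists ((z 0 i / x 0 i) *: x); rewrite ?memvZ ?memv_line ?subrK.
    by rewrite VE memvB ?memvZ //= !mxE divfK ?subrr.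
  by move: aV; rewrite VE => /andP[aU _]; rewrite memvD ?memvZ.
have x0 : x != 0 by apply: contraNneq xi0 => ->; rewrite mxE.
rewrite UE dimv_disjoint_sum ?dim_vline ?x0 ?addn1 //.
apply/eqP; rewrite -subv0; apply/subvP=> z /memv_capP[zV /vlineP[c zE]].
move: zV; rewrite VE zE !mxE mulf_eq0 (negPf xi0) orbF => /andP[_ /eqP->].
by rewrite scale0r mem0v.
Qed.

Lemma herm_hull_variation (F : finFieldType) (q n : nat) (C : {vspace 'rV[F]_n})
    (k m j : nat) :
  prime_power q -> (2 < q)%N -> #|F| = (q ^ 2)%N -> code_params C k m ->
  (j <= \dim (herm_hull q C))%N ->
  exists2 C' : {vspace 'rV[F]_n}, code_params C' k m & \dim (herm_hull q C') = j.
Proof.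
move=> qP q_gt2 cardF; have [g g0 g1] := exists_norm_neq1 q_gt2 cardF.
(* Induction on the excess [r] of the hull dimension over [j]; each scaling lowers it by one. *)
move rE: (\dim (herm_hull q C) - j)%N => r.
elim: r C rE => [|r IHr] C rE CP jle.
  by exists C => //; apply/eqP; rewrite eqn_leq jle -subn_eq0 rE eqxx.
have hull_gt0 : (0 < \dim (herm_hull q C))%N by lia.
have [x xH x0] : exists2 x, x \in herm_hull q C & x != 0.
  exists (vpick (herm_hull q C)); first exact: memv_pick.
  by rewrite vpick0 -dimv_eq0 -lt0n.
have [i xi0] : exists i, x 0 i != 0 by apply/rV0Pn.
have hullE := dim_coord_hyperplane xH xi0
  (herm_hull_scale qP cardF xH xi0 g1).
apply: (IHr (scale (\row_l (if l == i then g else 1)) @: C)%VS); try lia.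
apply: code_params_scale CP => l; rewrite mxE.
by case: ifP; rewrite ?oner_eq0.
Qed.

(** * Arithmetic of the exponents *)

(* If (n - 1) s = b + q a then, as n - 1 = K (q + 1), b - a = c (q + 1) with
   c = s K - a, and the size bounds leave c in {-1, 0, 1}. Since K divides
   q - 1, for c = -1 the multiple s K of K would lie strictly between q - 1 and
   q - 1 + K, and for c = 1 strictly between 0 and K. *)
Lemma exponent_collision (q n k' : nat) :
  odd q -> (2 < q)%N -> odd n -> (1 < n)%N -> (n - 1 %| q ^ 2 - 1)%N ->
  (n - 1 %| kdim n q * (q + 1))%N -> (1 <= k')%N ->
  k'%:Z <= (kdim n q)%:Z + i_min n q + 1 ->
  (k' <= n)%N /\
  forall a b, (a < k')%N -> (b < k')%N -> (n - 1 %| b + q * a)%N -> a = b.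
Proof.
move=> q_odd q_gt2 n_odd n_gt1 hdvd hk hk'1; rewrite /i_min => hk'2.
set K := kdim n q in hk hk'2 *.
have KE1 : (K * (q + 1) <= n + q - 1)%N by apply: leq_trunc_div.
have KE2 : (n + q - 1 < K * (q + 1) + (q + 1))%N.
  by rewrite -{2}[(q + 1)%N]mul1n -mulnDl addn1 ltn_ceil ?addn1.
(* The two entries of the minimum in [i_min] give one bound each; in the entry with the floor, [K]
   cancels. *)
have k'1 : (k'.-1 <= K + q - 1)%N.
  clear -hk'2 q_gt2; lia.
have k'2 : (2 * k'.-1 + q <= n)%N \/ k' = 1%N.
  clear -hk'2 hk'1; lia.
split=> [|a b ak bk]; first by clear -k'2 hk'1 q_gt2 n_gt1; lia.
have [k'E|k'_gt1] := leqP k' 1; first by lia.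
case: k'2 => [k'2|]; last by lia.
have qn : (q < n)%N by lia.
(* The floor gives [n - 1 <= K (q + 1) <= n + q - 1 < 2 (n - 1)], so the quotient [s] can only be
   1. *)
have nE : (n - 1 = K * (q + 1))%N.
  case/dvdnP: hk => s sE.
  have s2 : (s < 2)%N.
    rewrite ltnNge; apply/negP=> h.
    have : (2 * (n - 1) <= s * (n - 1))%N by rewrite leq_mul2r; lia.
    lia.
  have s1 : (0 < s)%N by case: s sE s2 => // sE; lia.
  have sE1 : s = 1%N by lia.
  by rewrite sE1 in sE; lia.
have [t tE] : exists t, (q = t * K + 1)%N.
  move: hdvd; rewrite nE (_ : q ^ 2 - 1 = (q - 1) * (q + 1))%N; last first.
    by rewrite -(subn_sqr q 1).
  by rewrite dvdn_pmul2r ?addn1 // => /dvdnP[t tE]; exists t; lia.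
rewrite nE => /dvdnP[s]; rewrite mulnA => sE.
have t_gt0 : (0 < t)%N by case: t tE => // tE; lia.
have Kq : (K < q)%N.
  by rewrite tE addn1 ltnS leq_pmull.
have [aK bK] : (a <= K + q - 1)%N /\ (b <= K + q - 1)%N by lia.
have between r m : (m * K < r * K -> r * K < m.+1 * K -> False)%N.
  by rewrite !ltn_mul2r ltnS => /andP[_ +] /andP[_]; rewrite ltnNge => /negP.
have e1 : ((b + q * a)%:Z - (q + 1)%:Z * a%:Z = b%:Z - a%:Z)%R by lia.
have e2 : ((q + 1)%:Z * ((s * K)%:Z - a%:Z) = b%:Z - a%:Z)%R.
  by rewrite -e1 sE; lia.
move cdef : ((s * K)%:Z - a%:Z)%R e2 => c e2.
(* Here [(q + 1) |c| = |b - a| <= K + q - 1 < 2 (q + 1)], because [K < q]. *)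
have cE : (c = -1 \/ c = 0 \/ c = 1)%R.
  clear -e2 aK bK Kq; nia.
case: cE => [cE|[cE|cE]]; rewrite cE in e2.
- by case: (between s t); rewrite ?mulSn; lia.
- lia.
- by case: (between s 0%N); rewrite ?mulSn; lia.
Qed.

(** * Power sums weighted by [u_coef] *)

(* Multiplication by an (n-1)-st root of unity z permutes the evaluation points
   and preserves the u_l, so it multiplies the sum by z^e. *)
Lemma sum_u_coef_expr (F : finFieldType) (n : nat) (alpha : 'I_n -> F) (e : nat) :
  (1 < n)%N -> evaluation_points alpha -> ~~ (n.-1 %| e)%N ->
  \sum_l u_coef alpha l * alpha l ^+ e = 0.
Proof.
move=> n_gt1 [alpha_inj alpha1 alpha0] Ne.
have alphan l : alpha l ^+ n = alpha l.
  have [ln|ln] := ltnP l n.-1; last first.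
    rewrite alpha0 ?expr0n ?gtn_eqF //; first by lia.
    by have := ltn_ord l; lia.
  by rewrite -[n]prednK ?(ltnW n_gt1) // exprS alpha1 ?mulr1.
(* The [n] evaluation points exhaust the roots of [X^n - X]: a further one would exceed its
   degree. *)
have alphaP x : x ^+ n = x -> exists l, alpha l = x.
  move=> xn; have [|/existsPn xP] := boolP [exists l, alpha l == x].
    by case/existsP=> l /eqP; exists l.
  have p_size : size ('X^n - 'X : {poly F}) = n.+1.
    by rewrite size_polyDl ?size_polyXn // size_polyN size_polyX.
  have p0 : 'X^n - 'X != 0 :> {poly F} by rewrite -size_poly_eq0 p_size.
  have := @max_poly_roots _ _ (x :: codom alpha) p0.
  rewrite /= p_size size_codom card_ord ltnn => h; suff: false by []; apply: h.
    rewrite /= rootE !hornerE xn subrr eqxx; apply/allP=> _ /codomP[l ->].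
    by rewrite rootE !hornerE alphan subrr.
  rewrite -/(injectiveb _) andbC; apply/andP; split; first exact/injectiveP.
  by apply/codomP=> -[l xE]; have := xP l; rewrite xE eqxx.
(* The nonzero points are [n - 1] distinct roots of unity, so one of them is primitive, and [n - 1]
   does not divide [e]. *)
have [z zN ze] : exists2 z : F, z ^+ n.-1 = 1 & z ^+ e != 1.
  pose f := alpha \o widen_ord (leq_pred n).
  have : has n.-1.-primitive_root (codom f).
    apply: has_prim_root; rewrite ?size_codom ?card_ord //; first by lia.
      by apply/allP=> _ /codomP[l ->]; rewrite unity_rootE alpha1 //=.
    apply/injectiveP; apply: inj_comp => // l l' /(congr1 val) ll'.
    exact: val_inj.
  case/hasP=> z _ zP; exists z; first exact: prim_expr_order.
  by rewrite -(prim_order_dvd zP).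
have z0 : z != 0.
  apply/eqP=> z0; move/eqP: zN; rewrite z0 expr0n gtn_eqF; last by lia.
  by rewrite eq_sym oner_eq0.
have /fin_all_exists[s sE] l : exists l', alpha l' = z * alpha l.
  apply: alphaP; rewrite exprMn alphan; congr (_ * _).
  by rewrite -[n]prednK ?(ltnW n_gt1) // exprS zN mulr1.
have s_inj : injective s.
  by move=> l l' ss; apply/alpha_inj/(mulfI z0); rewrite -!sE ss.
(* Each of the [n - 1] factors gains [z^-1], and [z^(n-1) = 1]. *)
have uE l : u_coef alpha (s l) = u_coef alpha l.
  rewrite /u_coef (reindex_inj s_inj) /=.
  under eq_bigl => i do rewrite (inj_eq s_inj).
  under eq_bigr => i _ do rewrite !sE -mulrBr invfM.
  rewrite big_split /= prodr_const.
  rewrite (_ : #|_| = n.-1) ?exprVn ?zN ?invr1 ?mul1r //.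
  have := cardC1 l; rewrite card_ord => <-; apply: eq_card => i.
  by rewrite !inE.
set T := \sum_l _.
have : T = z ^+ e * T.
  rewrite {1}/T (reindex_inj s_inj) /T mulr_sumr; apply: eq_bigr => l _ /=.
  by rewrite uE sE exprMn mulrCA.
move/eqP; rewrite -subr_eq0 -{1}[T]mul1r -mulrBl mulf_eq0 subr_eq0 eq_sym.
by rewrite (negPf ze) => /eqP.
Qed.

(** * Generalized Reed-Solomon codes *)

Definition grs_word (F : finFieldType) (n : nat) (alpha v : 'I_n -> F)
  (p : {poly F}) : 'rV[F]_n := \row_l (v l * p.[alpha l]).

(** The exponent list is arbitrary so that one freeness lemma serves both the whole code and the
    part inside its hull. *)
Definition grs_monomials (F : finFieldType) (n : nat) (alpha v : 'I_n -> F)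
  (s : seq nat) : seq 'rV[F]_n := [seq grs_word alpha v 'X^a | a <- s].

Definition grs_code (F : finFieldType) (n : nat) (alpha v : 'I_n -> F)
  (k : nat) : {vspace 'rV[F]_n} := <<grs_monomials alpha v (iota 0 k)>>%VS.

Lemma grs_word_sum (F : finFieldType) (n : nat) (alpha v : 'I_n -> F)
    (I : finType) (c : I -> F) (p : I -> {poly F}) :
  grs_word alpha v (\sum_i c i *: p i) = \sum_i c i *: grs_word alpha v (p i).
Proof.
apply/rowP=> l; rewrite summxE !mxE horner_sum mulr_sumr.
by apply: eq_bigr => i _; rewrite !mxE hornerZ mulrCA.
Qed.

Lemma card_poly_roots (F : finFieldType) (n : nat) (alpha : 'I_n -> F)
    (p : {poly F}) :
  injective alpha -> p != 0 -> (#|[set l | root p (alpha l)]| < size p)%N.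
Proof.
move=> alpha_inj p0; rewrite cardE -(size_map alpha); apply: max_poly_roots => //.
  by apply/allP=> _ /mapP[l + ->]; rewrite mem_enum inE.
by rewrite map_inj_uniq ?enum_uniq.
Qed.

Lemma grs_word_eq0 (F : finFieldType) (n : nat) (alpha v : 'I_n -> F)
    (p : {poly F}) :
  injective alpha -> (forall i, v i != 0) -> (size p <= n)%N ->
  grs_word alpha v p = 0 -> p = 0.
Proof.
move=> alpha_inj v0 pn /rowP p_eval; apply/eqP; move: pn.
apply: contraLR => p0; rewrite -ltnNge.
apply: leq_trans (card_poly_roots alpha_inj p0).
rewrite -[X in (X < _)%N]card_ord ltnS -cardsT; apply: subset_leq_card.
apply/subsetP=> l _; rewrite inE /root; have /eqP := p_eval l.
by rewrite !mxE mulf_eq0 (negPf (v0 l)).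
Qed.

(** A linear relation is a polynomial of size at most [n] vanishing at [n] distinct points, hence
    zero; distinct exponents let each coefficient be read off. *)
Lemma grs_monomials_free (F : finFieldType) (n : nat) (alpha v : 'I_n -> F)
    (s : seq nat) :
  injective alpha -> (forall i, v i != 0) -> uniq s -> all (ltn^~ n) s ->
  free (grs_monomials alpha v s).
Proof.
move=> alpha_inj v0 s_uniq /allP s_lt.
apply/(@freeP _ _ _ (in_tuple (grs_monomials alpha v s))).
move=> /= c c0 j.
have i_lt (i : 'I_(size (grs_monomials alpha v s))) : (i < size s)%N.
  by apply: leq_trans (ltn_ord i) _; rewrite size_map.
pose p := \sum_i c i *: 'X^(nth 0%N s i).
have : p = 0.
  apply: grs_word_eq0 alpha_inj v0 _ _.
    rewrite (leq_trans (size_sum _ _ _)) //.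
    apply/bigmax_leqP=> i _; rewrite (leq_trans (size_scale_leq _ _)) //.
    by rewrite size_polyXn; apply/s_lt/mem_nth.
  rewrite grs_word_sum -[RHS]c0; apply: eq_bigr => i _ /=.
  by rewrite (nth_map 0%N).
move/polyP/(_ (nth 0%N s j)); rewrite coef0 coef_sum (bigD1 j) //=.
rewrite coefZ coefXn eqxx mulr1 big1 ?addr0 // => i ij.
by rewrite coefZ coefXn nth_uniq // val_eqE eq_sym (negPf ij) mulr0.
Qed.

Lemma mem_grs_code (F : finFieldType) (n : nat) (alpha v : 'I_n -> F)
    (k : nat) (x : 'rV[F]_n) :
  reflect (exists2 p : {poly F}, (size p <= k)%N & x = grs_word alpha v p)
          (x \in grs_code alpha v k).
Proof.
apply: (iffP idP) => [/(@coord_span _ _ _ (in_tuple _)) ->|[p pk ->]].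
  exists (\sum_i coord (in_tuple (grs_monomials alpha v (iota 0 k))) i x *: 'X^i).
    apply: leq_trans (size_sum _ _ _) _; apply/bigmax_leqP=> i _.
    rewrite (leq_trans (size_scale_leq _ _)) // size_polyXn.
    by apply: leq_trans (ltn_ord i) _; rewrite size_map size_iota.
  rewrite grs_word_sum; apply: eq_bigr => i _ /=; congr (_ *: _).
  have ik : (i < k)%N.
    by apply: leq_trans (ltn_ord i) _; rewrite size_map size_iota.
  by rewrite (nth_map 0%N) ?size_iota // nth_iota.
rewrite -(coefK p) poly_def grs_word_sum; apply: memv_suml => i _.
apply/memvZ/memv_span/map_f; rewrite mem_iota /=.
exact: leq_trans (ltn_ord i) pk.
Qed.

(** Two codewords agree exactly at the roots of the difference of their polynomials, and distinct
    ones therefore at no more than [k - 1] points. *)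
Lemma grs_code_params (F : finFieldType) (n : nat) (alpha v : 'I_n -> F)
    (k : nat) :
  injective alpha -> (forall i, v i != 0) -> (0 < k <= n)%N ->
  code_params (grs_code alpha v k) k (n - k + 1).
Proof.
move=> alpha_inj v0 /andP[k_gt0 kn].
have distE p r : hamming_dist (grs_word alpha v p) (grs_word alpha v r) =
    (n - #|[set l | root (p - r) (alpha l)]|)%N.
  have := cardsC [set l | root (p - r) (alpha l)]; rewrite card_ord => cardE.
  rewrite -[X in (X - _)%N]cardE addKn; congr #|pred_of_set _|.
  apply/setP=> l; rewrite !inE !mxE.
  by rewrite (inj_eq (mulfI (v0 l))) /root !hornerE subr_eq0.
split.
  rewrite (eqP (grs_monomials_free alpha_inj v0 (iota_uniq 0 k) _)).
    by rewrite size_map size_iota.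
  by apply/allP=> a; rewrite mem_iota /= => /leq_trans; apply.
split; last first.
  move=> _ _ /mem_grs_code[p pk ->] /mem_grs_code[r rk ->] pr.
  have pr0 : p - r != 0 by rewrite subr_eq0; apply: contraNneq pr => ->.
  have := card_poly_roots alpha_inj pr0.
  have : (size (p - r)%R <= k)%N.
    by rewrite (leq_trans (size_polyD _ _)) // size_polyN geq_max pk.
  by rewrite distE; lia.
have k1n : (k.-1 <= n)%N by lia.
(* The bound is attained: the monic [p] vanishing exactly at the first [k - 1] points has size
   [k]. *)
pose A := [set widen_ord k1n i | i : 'I_k.-1].
have cardA : #|A| = k.-1.
  by rewrite card_imset ?card_ord // => i i' /(congr1 val) /= /val_inj.
pose p := \prod_(i <- enum A) ('X - (alpha i)%:P).
have p_size : size p = k by rewrite size_prod_XsubC -cardE cardA prednK.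
have p_roots : [set l | root (p - 0) (alpha l)] = A.
  apply/setP=> l; rewrite inE subr0.
  rewrite /p -(big_map alpha xpredT (fun a => 'X - a%:P)).
  by rewrite root_prod_XsubC mem_map // mem_enum.
have pC : grs_word alpha v p \in grs_code alpha v k.
  by apply/mem_grs_code; exists p; rewrite ?p_size.
have C0 : grs_word alpha v 0 \in grs_code alpha v k.
  by apply/mem_grs_code; exists 0; rewrite ?size_poly0.
exists (grs_word alpha v p), (grs_word alpha v 0); split=> //; last first.
  by rewrite distE p_roots cardA; lia.
apply/eqP=> p_eq0; have := distE p 0.
rewrite p_eq0 p_roots cardA /hamming_dist.
rewrite (_ : [set _ | _] = set0) ?cards0; last first.
  by apply/setP=> l; rewrite !inE eqxx.
by lia.
Qed.

Lemma herm_grs_monomials (F : finFieldType) (q n : nat) (alpha v : 'I_n -> F)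
    (a b : nat) :
  herm q (grs_word alpha v 'X^a) (grs_word alpha v 'X^b) =
  \sum_l v l ^+ q.+1 * alpha l ^+ (b + q * a).
Proof.
apply: eq_bigr => l _; rewrite !mxE !hornerXn exprMn mulrACA -exprS.
by rewrite -exprM -exprD mulnC.
Qed.

(** * Existence of the codes *)

Theorem theorem6 (q n : nat) (F : finFieldType)
    (hq : prime_power q) (hF : #|F| = (q ^ 2)%N)
    (hn : odd n) (hdvd : (n - 1 %| q ^ 2 - 1)%N)
    (hk : (n - 1 %| kdim n q * (q + 1))%N)
    (alpha v : 'I_n -> F)
    (halpha : evaluation_points alpha)
    (hv : column_multipliers q alpha v)
    (k' : nat) (hk'1 : (1 <= k')%N)
    (hk'2 : k'%:Z <= (kdim n q)%:Z + i_min n q + 1)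
    (j : nat) (hj : (j <= k' - #|Delta q alpha v k'|)%N) :
  exists C : {vspace 'rV[F]_n},
    [/\ MDS C, code_params C k' (n - k' + 1) & \dim (herm_hull q C) = j].
Proof.
have q_gt1 : (1 < q)%N.
  by case: hq => p [e [p_pr e_gt0 ->]]; rewrite -(exp1n e) ltn_exp2r ?prime_gt1.
have q2_gt1 : (1 < q ^ 2)%N by rewrite -(exp1n 2) ltn_exp2r.
have n_gt1 : (1 < n)%N.
  rewrite ltnNge; apply/negP=> n_le1; move: hdvd.
  have /eqP-> : (n - 1 == 0)%N by rewrite subn_eq0.
  by rewrite dvd0n; lia.
(* The even number [n - 1] divides [q^2 - 1]. This excludes [q = 2], where every nonzero element has
   norm 1. *)
have q_odd : odd q.
  have : (2 %| q ^ 2 - 1)%N.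
    by apply: dvdn_trans hdvd; rewrite dvdn2 oddB ?hn //; lia.
  by rewrite dvdn2 oddB ?oddX 1?ltnW //=; case: (odd q).
have q_gt2 : (2 < q)%N by lia.
have [k'n collision] := exponent_collision q_odd q_gt2 hn n_gt1 hdvd hk hk'1 hk'2.
have [alpha_inj _ _] := halpha.
have v0 i : v i != 0 by case: (hv i).
have CP := grs_code_params (k := k') alpha_inj v0 (introT andP (conj hk'1 k'n)).
have [|C' C'P hullC'] := herm_hull_variation (j := j) hq q_gt2 hF CP; last first.
  exists C'; split=> //; case: C'P => dimC'.
  by rewrite /MDS dimC'.
apply: leq_trans hj _.
(* The words with exponents in [s] are free and will span a subspace of the hull. *)
pose s := [seq a <- iota 0 k' | delta q alpha v a == 0].
have s_size : size s = (k' - #|Delta q alpha v k'|)%N.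
  rewrite size_filter -[X in _ = (X - _)%N](size_iota 0 k').
  rewrite -(count_predC (fun a => delta q alpha v a == 0)).
  suff -> : #|Delta q alpha v k'| =
      count (predC (fun a => delta q alpha v a == 0)) (iota 0 k') by rewrite addnK.
  rewrite cardE /enum_mem size_filter -enumT -val_enum_ord count_map.
  by apply: eq_count => a; rewrite !inE.
have s_mem a : a \in s -> (a < k')%N /\ delta q alpha v a = 0.
  by rewrite mem_filter mem_iota => /andP[/eqP].
have s_free : free (grs_monomials alpha v s).
  apply: grs_monomials_free; rewrite ?filter_uniq ?iota_uniq //.
  by apply/allP=> a /s_mem[ak _]; exact: leq_trans ak k'n.
rewrite -s_size -(size_map (fun a => grs_word alpha v 'X^a) s) -(eqP s_free).
apply/dimvS/span_subvP=> _ /mapP[a /s_mem[ak da] ->].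
rewrite memv_cap memv_span /=; last by apply: map_f; rewrite mem_iota.
(* Conjugation puts [y] into the linear argument, so orthogonality need only be checked on the
   spanning monomials. *)
apply/herm_dualP=> y yC; rewrite -(herm_conj _ _ hq hF).
suff -> : herm q (grs_word alpha v 'X^a) y = 0 by rewrite expr0n gtn_eqF // ltnW.
suff /subvP/(_ _ yC) :
    (grs_code alpha v k' <= lker (linfun (herm q (grs_word alpha v 'X^a))))%VS.
  by rewrite memv_ker lfunE /= => /eqP.
apply/span_subvP=> _ /mapP[b + ->]; rewrite mem_iota /= => bk.
rewrite memv_ker lfunE /= herm_grs_monomials; apply/eqP.
(* On the diagonal the exponent is [a (q + 1)] and the sum is [delta_a]; off it, [collision] forbids
   [n - 1] from dividing the exponent. *)
have [->|ab] := eqVneq b a.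
  by rewrite -[RHS]da; apply: eq_bigr => l _; rewrite mulnC -mulnS.
under eq_bigr => l _ do rewrite (hv l).2.
apply: sum_u_coef_expr => //.
by apply: contraNN ab => /[!(=^~ subn1)] /collision-> //.
Qed.
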